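(* Let $d\ge 2$ be an integer and let $4/d<\sigma<4$. Let $\psi$ be a ring-type singular solution of the radial biharmonic nonlinear Schrödinger equation $$ i\psi_t(t,r)-\Delta_r^2\psi+|\psi|^{2\sigma}\psi=0,\qquad \psi(0,r)=\psi_0(r), $$ which becomes singular at time $T_c<\infty$ and whose asymptotic profile $\psi_{Q}$ in the ring region has amplitude $$ |\psi_{Q}(t,r)|=\frac{1}{L^{2/\sigma}(t)}\,|Q(\rho)|,\qquad \rho=\frac{r-r_{\max}(t)}{L(t)},\qquad r_{\max}(t)\sim r_0L^{\alpha}(t)\quad (t\to T_c), $$ with $r_0>0$ and $\alpha\le 1$. Then $$ \alpha\ \ge\ \alpha_B,\qquad\text{where}\qquad \alpha_B=\frac{4-\sigma}{\sigma(d-1)}>0. $$ Therefore the ring is shrinking, i.e. $\lim_{t\to T_c}r_{\max}(t)=0$.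
   Context: Here $r=|\mathbf{x}|$, $\mathbf{x}\in\mathbb{R}^d$, and $$\Delta_r^2=\partial_r^4+\frac{2(d-1)}{r}\partial_r^3+\frac{(d-1)(d-3)}{r^2}\partial_r^2-\frac{(d-1)(d-3)}{r^3}\partial_r$$ is the radial biharmonic operator (the restriction of $\Delta^2$ to radial functions on $\mathbb{R}^d$). Solutions are radial, $\psi\in C([0,T_c);H^2(\mathbb{R}^d))$ with $\psi_0\in H^2(\mathbb{R}^d)$, and the equation conserves the power: $\|\psi(t)\|_2^2=\|\psi_0\|_2^2$ for $0\le t<T_c$. The solution is singular at $T_c<\infty$ if $\lim_{t\to T_c}\|\psi(t)\|_{H^2}=\infty$. The ring radius is $r_{\max}(t)=\arg\max_r|\psi(t,r)|$, and a singular solution is ring-type if $r_{\max}(t)>0$ for $0\le t<T_c$. The function $L(t)>0$ is the ring width, with $L(t)\to0$ as $t\to T_c$. The profile $Q$ is a continuous function, not identically zero, with $|Q|$ attaining its global maximum at $\rho=0$. ''The asymptotic profile of $\psi$ is $\psi_Q$'' (quasi self-similar collapse) means that $\psi\sim\psi_Q$ as $t\to T_c$ in the ring region $r-r_{\max}(t)=\mathcal{O}(L(t))$, i.e. for $|\rho|\le\rho_c$ with some fixed constant $\rho_c>0$ (but not necessarily for all $r\ge0$). In terms of amplitudes: $L^{2/\sigma}(t)\,|\psi(t,r_{\max}(t)+\rho L(t))|\to|Q(\rho)|$ as $t\to T_c$, uniformly over $|\rho|\le\rho_c$ with $r_{\max}(t)+\rho L(t)>0$. The notation $r_{\max}(t)\sim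 r_0L^\alpha(t)$ means $r_{\max}(t)/(r_0L^{\alpha}(t))\to1$ as $t\to T_c$. *)

(* Defs.v *)
From HB Require Import structures.
From mathcomp Require Import all_boot all_order all_algebra.
From mathcomp Require Import all_classical all_reals all_analysis.
From mathcomp Require Import complex.

Set Implicit Arguments.
Unset Strict Implicit.
Unset Printing Implicit Defensive.

Import Order.TTheory GRing.Theory Num.Theory.
Import numFieldNormedType.Exports.
Import Normc.

Local Open Scope classical_set_scope.
Local Open Scope ring_scope.
Local Open Scope complex_scope.

(** * Lebesgue measure on R^n

   ['rV[R]_n] carries the sigma-algebra generated by the coordinates, and its
   Lebesgue measure is the n-fold product of the one-dimensional one, transported
   along R x R^n = R^(n+1). *)

Definition rV_display : measure_display. Proof. exact: default_measure_display. Qed.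

Section measurable_rV.
Context {R : realType} (n : nat).

Let coor (i : 'I_n) (x : 'rV[R]_n) : measurableTypeR R := x 0 i.

Let rV_set0 : g_sigma_preimage coor set0.
Proof. exact: sigma_algebra0. Qed.

Let rV_setC A : g_sigma_preimage coor A -> g_sigma_preimage coor (~` A).
Proof. exact: sigma_algebraC. Qed.

Let rV_bigcup (F : _^nat) : (forall i, g_sigma_preimage coor (F i)) ->
  g_sigma_preimage coor (\bigcup_i (F i)).
Proof. exact: sigma_algebra_bigcup. Qed.

HB.instance Definition _ := @isMeasurable.Build rV_display
  'rV[R]_n (g_sigma_preimage coor) rV_set0 rV_setC rV_bigcup.

End measurable_rV.

Lemma measurable_coor {R : realType} n (i : 'I_n) :
  measurable_fun setT (fun x : 'rV[R]_n => x 0 i : measurableTypeR R).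
Proof.
move=> _ Y mY; rewrite setTI; apply: sub_sigma_algebra => /=.
rewrite -bigcup_seq/=; exists i => /=; first by rewrite mem_index_enum.
by exists Y => //; rewrite setTI.
Qed.

Lemma measurable_fun_rV {R : realType} n d (T : measurableType d)
    (f : T -> 'rV[R]_n) :
  (forall i, measurable_fun setT (fun t => f t 0 i : measurableTypeR R)) ->
  measurable_fun setT f.
Proof.
move=> mf.
have : g_sigma_preimage (fun i t => f t 0 i : measurableTypeR R) `<=` measurable.
  apply: smallest_sub; first exact: sigma_algebra_measurable.
  case: n => [|n] in f mf *; first by rewrite big_ord0.
  rewrite -bigcup_mkord_ord; apply: bigcup_sub => i Ii.
  by move=> A [B mB <-]; exact: mf.
rewrite (g_sigma_preimage_comp
  (fun (i : 'I_n) (x : 'rV[R]_n) => x 0 i : measurableTypeR R)) => prefS _ A mA.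
by apply: prefS; exists A.
Qed.


Section lebesgue_rV.
Context {R : realType}.
Local Notation mu := (@lebesgue_measure R).

Definition cons_rV n (p : measurableTypeR R * 'rV[R]_n) : 'rV[R]_n.+1 :=
  row_mx (p.1%:M : 'rV[R]_1) p.2.

Lemma measurable_cons_rV n : measurable_fun setT (@cons_rV n).
Proof.
apply: measurable_fun_rV => i.
case: (@splitP 1 n i) => j ij.
- have -> : i = lshift n j by exact/val_inj.
  apply: (eq_measurable_fun fst) => // -[x y] _.
  apply/esym/(etrans (row_mxEl (x%:M : 'rV[R]_1) y 0 j)).
  by rewrite mxE ord1 eqxx mulr1n.
- have -> : i = rshift 1 j by exact/val_inj.
  apply: (eq_measurable_fun ((fun y : 'rV[R]_n => y 0 j) \o snd)).
    move=> -[x y] _.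
    exact/esym/(row_mxEr (x%:M : 'rV[R]_1) y 0 j).
  apply: (measurableT_comp (measurable_coor j)).
  exact: measurable_snd.
Qed.

Definition uncons_rV n (z : 'rV[R]_n.+1) : measurableTypeR R * 'rV[R]_n :=
  (z 0 0, rsubmx (z : 'rV[R]_(1 + n))).

Lemma measurable_uncons_rV n : measurable_fun setT (@uncons_rV n).
Proof.
apply/measurable_fun_pair; first exact: measurable_coor.
apply: measurable_fun_rV => i.
apply: (eq_measurable_fun (fun z : 'rV[R]_n.+1 => z 0 (rshift 1 i))).
  by move=> z _; rewrite /uncons_rV /= mxE.
exact: measurable_coor.
Qed.

Lemma cons_rVK n : cancel (@cons_rV n) (@uncons_rV n).
Proof.
case=> x y; rewrite /uncons_rV /cons_rV/= row_mxKr; congr pair.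
have -> : (0 : 'I_n.+1) = lshift n (0 : 'I_1) by apply/val_inj.
by apply: (etrans (row_mxEl (x%:M : 'rV[R]_1) y 0 0)); rewrite mxE eqxx mulr1n.
Qed.

Lemma uncons_rVK n : cancel (@uncons_rV n) (@cons_rV n).
Proof.
move=> z; pose z' : 'rV[R]_(1 + n) := z.
suff e : (z 0 0)%:M = lsubmx z' :> 'rV[R]_1.
  by rewrite -[RHS](hsubmxK z') -e.
apply/rowP => i; rewrite !mxE ord1 eqxx mulr1n; congr (z _ _).
exact/val_inj.
Qed.

Section step.
Variables (n : nat) (m : {sigma_finite_measure set 'rV[R]_n -> \bar R}).

Definition lebesgue_step : set 'rV[R]_n.+1 -> \bar R :=
  pushforward (mu \x m)%E (@cons_rV n).

Let P := [the {measure set _ -> \bar R} of (mu \x m)%E].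

Let step0 : lebesgue_step set0 = 0%E.
Proof. by rewrite /lebesgue_step /pushforward preimage_set0 measure0. Qed.

Let step_ge0 A : (0 <= lebesgue_step A)%E.
Proof. exact: (@measure_ge0 _ _ _ P). Qed.

Let step_sigma_additive : semi_sigma_additive lebesgue_step.
Proof.
move=> F mF tF mUF; rewrite /lebesgue_step /pushforward preimage_bigcup.
apply: (@measure_semi_sigma_additive _ _ _ P).
- by move=> k; rewrite -[X in measurable X]setTI; exact: measurable_cons_rV.
- apply/trivIsetP => /= i j _ _ ij; rewrite -preimage_setI.
  by move/trivIsetP : tF => /(_ _ _ _ _ ij) ->//; rewrite preimage_set0.
- rewrite -preimage_bigcup -[X in measurable X]setTI.
  exact: measurable_cons_rV.
Qed.

HB.instance Definition _ := isMeasure.Build _ _ _ lebesgue_step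
  step0 step_ge0 step_sigma_additive.

Let step_sigma_finite : sigma_finite setT lebesgue_step.
Proof.
have /sigma_finiteP[F [TF ndF Foo]] := sigma_finiteT mu.
have /sigma_finiteP[G [TG ndG Goo]] := sigma_finiteT m.
exists (fun k => @uncons_rV n @^-1` (F k `*` G k)).
  rewrite -preimage_bigcup -(preimage_setT (@uncons_rV n)); congr (_ @^-1` _).
  rewrite -setXTT TF TG predeqE => -[x y]; split.
    move=> [/= [p _ Fpx] [k _ Gky]]; exists (maxn p k) => //; split.
    - by move: x Fpx; exact/subsetPset/ndF/leq_maxl.
    - by move: y Gky; exact/subsetPset/ndG/leq_maxr.
  by move=> [p _ []/= ? ?]; split; exists p.
move=> k; have [mFk Fkoo] := Foo k; have [mGk Gkoo] := Goo k; split.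
  rewrite -[X in measurable X]setTI; apply: measurable_uncons_rV => //.
  exact: measurableX.
rewrite /lebesgue_step /pushforward -comp_preimage.
rewrite (_ : _ \o _ = id); last by apply/funext => p; exact: cons_rVK.
by rewrite preimage_id product_measure1E// lte_mul_pinfty// ge0_fin_numE.
Qed.

HB.instance Definition _ := Measure_isSigmaFinite.Build _ _ _ lebesgue_step
  step_sigma_finite.

End step.

Fixpoint lebesgue_rV n : {sigma_finite_measure set 'rV[R]_n -> \bar R} :=
  match n with
  | 0 => [the {sigma_finite_measure set 'rV[R]_0 -> \bar R} of \d_(0 : 'rV[R]_0)]
  | n.+1 => [the {sigma_finite_measure set 'rV[R]_n.+1 -> \bar R}
               of lebesgue_step (lebesgue_rV n)]
  end.

End lebesgue_rV.

Section complex_integral.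
Context d (T : measurableType d) (R : realType)
  (mu : {measure set T -> \bar R}).

Definition cintegrable (D : set T) (f : T -> R[i]) : Prop :=
  mu.-integrable D (fun x => (complex.Re (f x))%:E) /\
  mu.-integrable D (fun x => (complex.Im (f x))%:E).

Definition cintegral (D : set T) (f : T -> R[i]) : R[i] :=
  (\int[mu]_(x in D) complex.Re (f x)) +i* (\int[mu]_(x in D) complex.Im (f x)).

End complex_integral.

(** * Test functions, weak derivatives and H^2(R^d) *)

Section sobolev.
Context {R : realType} (d : nat).
Implicit Types (f g : 'rV[R]_d -> R[i]) (phi : 'rV[R]_d -> R).

Definition partials (s : seq 'I_d) phi : 'rV[R]_d -> R :=
  foldr (fun i h x => 'D_(delta_mx 0 i) h x) phi s.

Definition smooth phi : Prop := forall s,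
  continuous (partials s phi) /\
  forall i x, derivable (partials s phi) x (delta_mx 0 i).

Definition test_function phi : Prop :=
  smooth phi /\ compact (closure [set x | phi x != 0]).

Definition L2norm f : \bar R :=
  Lnorm (lebesgue_rV d) 2%:E (fun x => (normc (f x))%:E).

Definition in_L2 f : Prop :=
  [/\ measurable_fun setT (fun x => complex.Re (f x)),
      measurable_fun setT (fun x => complex.Im (f x)) &
      (L2norm f < +oo)%E].

Definition is_weak_partials (s : seq 'I_d) f g : Prop :=
  forall phi, test_function phi ->
    cintegral (lebesgue_rV d) setT (fun x => f x * (partials s phi x)%:C) =
    (-1) ^+ size s *
      cintegral (lebesgue_rV d) setT (fun x => g x * (phi x)%:C).

(* Well defined up to a null set when it exists in L^2, and 0 otherwise. *)
Definition weak_partials (s : seq 'I_d) f : 'rV[R]_d -> R[i] :=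
  xget (fun=> 0) [set g | in_L2 g /\ is_weak_partials s f g].

Definition in_H2 f : Prop :=
  in_L2 f /\ forall s : seq 'I_d, (size s <= 2)%N ->
    exists g, in_L2 g /\ is_weak_partials s f g.

(* (||f||_2^2 + ||grad f||_2^2 + ||Hessian f||_2^2)^(1/2), in [0, +oo]. *)
Definition H2norm f : \bar R :=
  ((L2norm f `^ 2
    + \sum_(i < d) L2norm (weak_partials [:: i] f) `^ 2
    + \sum_(i < d) \sum_(j < d) L2norm (weak_partials [:: i; j] f) `^ 2)
   `^ (2^-1))%E.

End sobolev.

(** * The radial biharmonic NLS *)

(* The norm of the library on ['rV[R]_d] is the sup norm. *)
Definition euclid {R : realType} {d} (x : 'rV[R]_d) : R :=
  Num.sqrt (\sum_i x 0 i ^+ 2).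

Definition radial {R : realType} (d : nat) {T} (f : R -> T) (x : 'rV[R]_d) : T :=
  f (euclid x).

Definition radial_bilaplacian {R : realType} (d : nat) (chi : R -> R) (r : R) : R :=
  derive1n 4 chi r
  + 2 * (d%:R - 1) / r * derive1n 3 chi r
  + (d%:R - 1) * (d%:R - 3) / r ^+ 2 * derive1n 2 chi r
  - (d%:R - 1) * (d%:R - 3) / r ^+ 3 * derive1 chi r.

Definition nonlinearity {R : realType} (sigma : R) (z : R[i]) : R[i] :=
  (normc z `^ (2 * sigma))%:C * z.

Definition pairing {R : realType} (d : nat) (f : R -> R[i]) (chi : R -> R) : R[i] :=
  cintegral (lebesgue_rV d) setT (radial (fun r => f r * (chi r)%:C)).

(* [psi t r] for [0 <= t < Tc] and [r = |x|]; negative [r] are irrelevant.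
   For a solution that is only H^2 in space the equation
   [i psi_t = Delta_r^2 psi - |psi|^(2 sigma) psi] is meant in the sense of
   distributions on [0, Tc) x R^d: it is integrated in time and paired with test
   functions of x, on which the symmetric operator [Delta_r^2] acts. As psi is
   radial, radial test functions suffice. [radial_bilaplacian d chi] has an
   irrelevant value at the single point r = 0. *)
Definition solves_radial_BNLS {R : realType} (d : nat) (sigma Tc : R)
    (psi0 : R -> R[i]) (psi : R -> R -> R[i]) : Prop :=
  (forall r, 0 <= r -> psi 0 r = psi0 r) /\
  forall chi : R -> R, test_function (radial chi : 'rV[R]_d -> R) ->
  forall t, 0 <= t < Tc ->
    [/\ forall s, 0 <= s <= t ->
          cintegrable (lebesgue_rV d) setT
            (radial (fun r => nonlinearity sigma (psi s r) * (chi r)%:C)),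
        cintegrable lebesgue_measure `[0, t]
          (fun s => pairing d (psi s) (radial_bilaplacian d chi)
                    - pairing d (fun r => nonlinearity sigma (psi s r)) chi) &
        'i%C * (pairing d (psi t) chi - pairing d psi0 chi) =
          cintegral lebesgue_measure `[0, t]
            (fun s => pairing d (psi s) (radial_bilaplacian d chi)
                      - pairing d (fun r => nonlinearity sigma (psi s r)) chi)].

Definition continuous_in_H2 {R : realType} (d : nat) (Tc : R)
    (psi : R -> R -> R[i]) : Prop :=
  (forall t, 0 <= t < Tc -> in_H2 (radial (psi t) : 'rV[R]_d -> R[i])) /\
  forall s, 0 <= s < Tc ->
    H2norm (radial (fun r => psi t r - psi s r) : 'rV[R]_d -> R[i])
      @[t --> within `[0, Tc[ (nbhs s)] --> 0%E.

(* For an H^2 solution in the sense above this is not a formal consequence of the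
   equation for all exponents sigma < 4 and all d; it is part of the notion of
   solution. *)
Definition conserves_power {R : realType} (d : nat) (Tc : R)
    (psi0 : R -> R[i]) (psi : R -> R -> R[i]) : Prop :=
  forall t, 0 <= t < Tc ->
    L2norm (radial (psi t) : 'rV[R]_d -> R[i]) =
    L2norm (radial psi0 : 'rV[R]_d -> R[i]).

Definition is_solution {R : realType} (d : nat) (sigma Tc : R)
    (psi0 : R -> R[i]) (psi : R -> R -> R[i]) : Prop :=
  [/\ in_H2 (radial psi0 : 'rV[R]_d -> R[i]),
      continuous_in_H2 d Tc psi,
      solves_radial_BNLS d sigma Tc psi0 psi &
      conserves_power d Tc psi0 psi].

Definition singular_at {R : realType} (d : nat) (Tc : R)
    (psi : R -> R -> R[i]) : Prop :=
  H2norm (radial (psi t) : 'rV[R]_d -> R[i]) @[t --> Tc^'-] --> +oo%E.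

(* [psi t] is a pointwise defined representative of its H^2 class, e.g. the one
   continuous on r > 0; the maximum and the profile refer to its values. *)
Definition is_ring_radius {R : realType} (Tc : R) (psi : R -> R -> R[i])
    (rmax : R -> R) : Prop :=
  forall t, 0 <= t < Tc ->
    0 <= rmax t /\
    forall r, 0 <= r -> normc (psi t r) <= normc (psi t (rmax t)).

Definition ring_type {R : realType} (Tc : R) (rmax : R -> R) : Prop :=
  forall t, 0 <= t < Tc -> 0 < rmax t.

Definition ring_width {R : realType} (Tc : R) (L : R -> R) : Prop :=
  (forall t, 0 <= t < Tc -> 0 < L t) /\ L t @[t --> Tc^'-] --> (0 : R).

Definition ring_profile {R : realType} (Q : R -> R[i]) : Prop :=
  [/\ continuous (fun rho => complex.Re (Q rho)),
      continuous (fun rho => complex.Im (Q rho)),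
      exists rho, Q rho != 0 &
      forall rho, normc (Q rho) <= normc (Q 0)].

(* Uniform convergence of the rescaled amplitude on the ring region
   |rho| <= rhoc only, nothing being assumed elsewhere. *)
Definition has_asymptotic_profile {R : realType} (sigma Tc : R)
    (psi : R -> R -> R[i]) (rmax L : R -> R) (Q : R -> R[i]) : Prop :=
  exists2 rhoc : R, 0 < rhoc &
  forall eps : R, 0 < eps -> \forall t \near Tc^'-,
    forall rho : R, `|rho| <= rhoc -> 0 < rmax t + rho * L t ->
      `| L t `^ (2 / sigma) * normc (psi t (rmax t + rho * L t))
         - normc (Q rho) | < eps.

Definition ring_radius_rate {R : realType} (Tc r0 alpha : R)
    (rmax L : R -> R) : Prop :=
  rmax t / (r0 * L t `^ alpha) @[t --> Tc^'-] --> (1 : R).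

Definition alphaB {R : realType} (d : nat) (sigma : R) : R :=
  (4 - sigma) / (sigma * (d%:R - 1)).

(* Main.v *)
Require Import Defs.
From HB Require Import structures.
From mathcomp Require Import all_boot all_order all_algebra.
From mathcomp Require Import all_classical all_reals all_analysis.
From mathcomp Require Import complex.
From mathcomp Require Import measurable_realfun ring lra.

Import Order.TTheory GRing.Theory Num.Theory.
Import numFieldNormedType.Exports.

Local Open Scope classical_set_scope.
Local Open Scope ring_scope.
Local Open Scope complex_scope.

(** The ring cannot hold more power than the solution has, and this limits how
   slowly its radius may shrink compared with its width.

   Write d = n + 1. By the asymptotic profile and the continuity of |Q| at its
   peak, |psi t r| is at least a constant times L^(-2/sigma) for r between rmax
   and rmax + delta L, with delta > 0 fixed ([ring_profile_near_peak]). In R^d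
   these r form an annulus whose volume is at least a constant times
   rmax^n * delta L ([annulus_measure_ge]), so the squared L^2 norm of psi t is
   at least a constant times L^(-4/sigma) * L * rmax^n ([L2norm_radial_ge]).
   This norm does not depend on t, and rmax is of order L^alpha; hence
   L^(1 - 4/sigma + alpha n) stays bounded while L tends to 0, which forces
   1 - 4/sigma + alpha n >= 0 ([exponent_ge0]). This inequality is
   alpha >= alphaB. As sigma < 4, alphaB and therefore alpha are positive, and
   rmax, being of order L^alpha, tends to 0.

   Only the outer side r >= rmax of the ring is used: there the condition r > 0
   of the profile holds automatically, even if rmax is small against L. *)

(** * Volume of annuli *)

(** The product measure is by definition an integral over the first coordinate;
   uniqueness of product measures allows the other order of integration, which
   suits sets whose sections in the first coordinate contain an interval of
   known length. *)
Lemma lebesgue_rV_cons {R : realType} n (A : set 'rV[R]_n.+1) :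
  measurable A ->
  lebesgue_rV n.+1 A =
  (\int[lebesgue_rV n]_y lebesgue_measure [set x | A (cons_rV (x, y))])%E.
Proof.
move=> mA; have mA' : measurable (@cons_rV R n @^-1` A).
  by rewrite -[X in measurable X]setTI; exact: measurable_cons_rV.
rewrite /= /lebesgue_step /pushforward.
rewrite (@product_measure_unique _ _ _ _ _ _ _
  (lebesgue_measure \x^ lebesgue_rV n)%E) //.
  by apply: eq_integral => y _ /=; congr lebesgue_measure; apply/seteqP;
    split => x /=; rewrite /ysection /= inE.
by move=> B C mB mC; exact: product_measure2E.
Qed.

Lemma lebesgue_measure_segment {R : realType} (u h : R) : 0 <= h ->
  lebesgue_measure (`[u, u + h]%classic : set R) = h%:E.
Proof.
rewrite lebesgue_measure_itv /= lte_fin ltrDl -EFinB addrAC subrr add0r.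
by case: ltgtP => // <-.
Qed.

Definition cube {R : realType} n (b : R) : set 'rV[R]_n :=
  [set y | forall i, 0 <= y 0 i <= b].

Lemma measurable_cube {R : realType} n (b : R) : measurable (cube n b).
Proof.
rewrite (_ : cube n b = \bigcap_(i in [set: 'I_n]) [set y | y 0 i \in `[0, b]]).
  apply: fin_bigcap_measurable => // i _.
  rewrite -[X in measurable X]setTI.
  exact: (@measurable_coor R n i measurableT `[0, b]%classic (measurable_itv _)).
apply/seteqP; split=> y /= hy i; first by move=> _; rewrite /= in_itv /= hy.
by have := hy i I; rewrite /= in_itv.
Qed.

Lemma lebesgue_rV_cube {R : realType} n (b : R) : 0 <= b ->
  lebesgue_rV n (cube n b) = (b ^+ n)%:E.
Proof.
move=> b0; elim: n => [|n IHn].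
  by rewrite /= diracE mem_set// => -[].
rewrite /= /lebesgue_step /pushforward.
rewrite (_ : @cons_rV R n @^-1` _ = `[0, b]%classic `*` cube n b); last first.
  apply/seteqP; split=> -[x y] /=.
    move=> h; split.
      have := h (lshift n (0 : 'I_1)); rewrite in_itv /=.
      by rewrite [cons_rV _ _ _](row_mxEl (x%:M : 'rV[R]_1) y 0 0) mxE eqxx mulr1n.
    move=> i; have := h (rshift 1 i).
    by rewrite [cons_rV _ _ _](row_mxEr (x%:M : 'rV[R]_1) y 0 i).
  rewrite in_itv /= => -[hx hy] i.
  case: (@splitP 1 n i) => j ij.
    have -> : i = lshift n j by exact/val_inj.
    by rewrite [cons_rV _ _ _](row_mxEl (x%:M : 'rV[R]_1) y 0 j) mxE ord1 eqxx mulr1n.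
  have -> : i = rshift 1 j by exact/val_inj.
  by rewrite [cons_rV _ _ _](row_mxEr (x%:M : 'rV[R]_1) y 0 j).
rewrite product_measure1E; [|exact: measurable_itv|exact: measurable_cube].
rewrite IHn exprS EFinM; congr (_ * _)%E.
by have := lebesgue_measure_segment 0 b b0; rewrite add0r; exact.
Qed.

Lemma euclid_cons_rV {R : realType} n (x : R) (y : 'rV[R]_n) :
  euclid (cons_rV (x, y)) = Num.sqrt (x ^+ 2 + euclid y ^+ 2).
Proof.
rewrite /euclid sqr_sqrtr; last by apply: sumr_ge0 => i _; exact: sqr_ge0.
congr Num.sqrt; rewrite big_ord_recl; congr (_ + _).
  have -> : (ord0 : 'I_n.+1) = lshift n (0 : 'I_1) by exact/val_inj.
  by rewrite [cons_rV _ _ _](row_mxEl (x%:M : 'rV[R]_1) y 0 0) mxE eqxx mulr1n.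
apply: eq_bigr => i _.
have -> : lift (ord0 : 'I_n.+1) i = rshift 1 i by exact/val_inj.
by rewrite [cons_rV _ _ _](row_mxEr (x%:M : 'rV[R]_1) y 0 i).
Qed.

Lemma measurable_euclid {R : realType} n :
  measurable_fun setT (@euclid R n : 'rV[R]_n -> measurableTypeR R).
Proof.
apply: (measurableT_comp (f := Num.sqrt : R -> R)).
  by apply: continuous_measurable_fun; exact: sqrt_continuous.
by apply: measurable_sum => i; apply: measurable_funX; exact: measurable_coor.
Qed.

Lemma euclid_cube {R : realType} n (b : R) (y : 'rV[R]_n) :
  cube n b y -> euclid y ^+ 2 <= n%:R * b ^+ 2.
Proof.
move=> hy; rewrite sqr_sqrtr; last by apply: sumr_ge0 => i _; exact: sqr_ge0.
apply: le_trans (ler_sum _ (G := fun=> b ^+ 2) _) _.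
  by move=> i _; have /andP[? ?] := hy i; rewrite lerXn2r// nnegrE; lra.
by rewrite sumr_const card_ord mulr_natl.
Qed.

Definition annulus {R : realType} n (a h : R) : set 'rV[R]_n :=
  [set x | a <= euclid x <= a + h].

Lemma measurable_annulus {R : realType} n (a h : R) :
  measurable (annulus n a h).
Proof.
rewrite -[X in measurable X]setTI.
rewrite (_ : annulus n a h = @euclid R n @^-1` `[a, a + h]).
  by apply: measurable_euclid => //; exact: measurable_itv.
by apply/seteqP; split=> y; rewrite /annulus /= in_itv.
Qed.

(** Only the part of the annulus over the cube [0, a / n]^n in the last n
   coordinates is kept. For y in that cube |y| <= a, so u = sqrt (a^2 - |y|^2)
   exists and the points (u, y) lie on the inner sphere. Moving the first
   coordinate from u to u + h stays in the annulus, since u <= a gives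
   (u + h)^2 + |y|^2 = a^2 + 2 u h + h^2 <= (a + h)^2. Each section thus has
   length at least h. *)
Lemma annulus_measure_ge {R : realType} n (a h : R) : (0 < n)%N ->
  0 <= a -> 0 <= h ->
  ((h * (a / n%:R) ^+ n)%:E <= lebesgue_rV n.+1 (annulus n.+1 a h))%E.
Proof.
move=> n0 a0 h0; have mA := @measurable_annulus R n.+1 a h.
have n1 : 1 <= n%:R :> R by rewrite ler1n.
set b := a / n%:R; have b0 : 0 <= b by rewrite divr_ge0.
have mA' : measurable (@cons_rV R n @^-1` annulus n.+1 a h).
  by rewrite -[X in measurable X]setTI; exact: measurable_cons_rV.
have msec : measurable_fun setT
    (fun y => lebesgue_measure [set x : R | annulus n.+1 a h (cons_rV (x, y))]).
  apply: eq_measurable_fun (measurable_fun_ysection lebesgue_measure mA').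
  move=> y _ /=; congr lebesgue_measure; apply/seteqP.
  by split => x /=; rewrite /ysection /= inE.
rewrite lebesgue_rV_cons// EFinM -(lebesgue_rV_cube n b b0).
rewrite -(integral_cst _ (measurable_cube n b)).
apply: (@le_trans _ _ (\int[lebesgue_rV n]_(y in cube n b)
  lebesgue_measure [set x | annulus n.+1 a h (cons_rV (x, y))])%E); last first.
  by apply: ge0_subset_integral => //; exact: measurable_cube.
apply: ge0_le_integral => //.
- exact: measurable_cube.
- by apply: measurable_funTS.
move=> y hy /=.
have hy2 : euclid y ^+ 2 <= a ^+ 2.
  apply: le_trans (euclid_cube n b y hy) _; rewrite /b expr_div_n.
  rewrite mulrCA ler_piMr ?sqr_ge0// expr2 invfM mulrA mulfV ?mul1r; last by lra.
  by rewrite invf_le1 //; lra.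
set u := Num.sqrt (a ^+ 2 - euclid y ^+ 2).
have u0 : 0 <= u by exact: sqrtr_ge0.
have u2 : u ^+ 2 = a ^+ 2 - euclid y ^+ 2 by rewrite sqr_sqrtr ?subr_ge0.
have ua : u <= a.
  by rewrite -(ler_pXn2r (_ : 0 < 2)%N) ?nnegrE // u2 gerBl sqr_ge0.
rewrite -(lebesgue_measure_segment u h h0).
apply: le_measure; rewrite ?inE.
- exact: measurable_itv.
- have := @measurable_ysection _ _ _ _ _ y mA'.
  rewrite (_ : ysection _ _ = [set x | annulus n.+1 a h (cons_rV (x, y))])//.
  by apply/seteqP; split => x /=; rewrite /ysection /= inE.
move=> x /=; rewrite in_itv /= => /andP[ux xuh].
rewrite /annulus /= euclid_cons_rV.
have e0 := sqr_ge0 (euclid y).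
have s0 : 0 <= x ^+ 2 + euclid y ^+ 2 by rewrite addr_ge0 ?sqr_ge0.
apply/andP; split;
  rewrite -(ler_pXn2r (_ : 0 < 2)%N) ?nnegrE ?sqrtr_ge0 ?addr_ge0//.
  by rewrite sqr_sqrtr//; nra.
by rewrite sqr_sqrtr//; nra.
Qed.

(** * Power carried by a ring *)

Lemma normc_ge0 {R : realType} (z : R[i]) : 0 <= Normc.normc z.
Proof. by case: z => u v; rewrite /= sqrtr_ge0. Qed.

Lemma sqr_normc {R : realType} (z : R[i]) :
  Normc.normc z ^+ 2 = complex.Re z ^+ 2 + complex.Im z ^+ 2.
Proof. by case: z => u v /=; rewrite sqr_sqrtr// addr_ge0 ?sqr_ge0. Qed.

Lemma continuous_normc {R : realType} (Q : R -> R[i]) :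
  continuous (fun r => complex.Re (Q r)) ->
  continuous (fun r => complex.Im (Q r)) ->
  continuous (fun r => Normc.normc (Q r)).
Proof.
move=> cR cI; rewrite (_ : (fun r => _) =
    Num.sqrt \o (fun r => complex.Re (Q r) ^+ 2 + complex.Im (Q r) ^+ 2)).
  move=> r; apply: continuous_comp; last exact: sqrt_continuous.
  by apply: cvgD; rewrite expr2; apply: cvgM; (exact: cR || exact: cI).
by apply/funext => r /=; case: (Q r).
Qed.

Lemma L2norm_chebyshev {R : realType} d (f : 'rV[R]_d -> R[i])
    (A : set 'rV[R]_d) (c : R) :
  in_L2 f -> measurable A -> 0 <= c ->
  (forall x, A x -> c <= Normc.normc (f x)) ->
  ((c ^+ 2)%:E * lebesgue_rV d A <= L2norm f `^ 2)%E.
Proof.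
move=> [mR mI _] mA c0 cA; rewrite /L2norm poweR_Lnorm//.
have sqE x : (`|(Normc.normc (f x))%:E| `^ 2)%E =
    (complex.Re (f x) ^+ 2 + complex.Im (f x) ^+ 2)%:E.
  by rewrite abse_EFin poweR_EFin powR_mulrn// real_normK ?num_real// sqr_normc.
have msq : measurable_fun setT
    (fun x => (complex.Re (f x) ^+ 2 + complex.Im (f x) ^+ 2)%:E).
  by apply/measurable_EFinP; apply: measurable_funD; apply: measurable_funX.
under eq_integral do rewrite sqE.
rewrite -(integral_cst _ mA).
apply: (@le_trans _ _ (\int[lebesgue_rV d]_(x in A)
    (complex.Re (f x) ^+ 2 + complex.Im (f x) ^+ 2)%:E)%E); last first.
  by apply: ge0_subset_integral => // x _; rewrite lee_fin addr_ge0 ?sqr_ge0.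
apply: ge0_le_integral => //.
- by move=> x _; rewrite lee_fin sqr_ge0.
- exact: measurable_funTS.
move=> x Ax; rewrite lee_fin -sqr_normc lerXn2r ?nnegrE ?normc_ge0//.
exact: cA.
Qed.

Lemma L2norm_radial_ge {R : realType} n (f : R -> R[i]) (c a h : R) :
  (0 < n)%N -> in_L2 (radial f : 'rV[R]_n.+1 -> R[i]) ->
  0 <= a -> 0 <= h -> 0 <= c ->
  (forall r, a <= r <= a + h -> c <= Normc.normc (f r)) ->
  ((c ^+ 2 * (h * (a / n%:R) ^+ n))%:E <=
     L2norm (radial f : 'rV[R]_n.+1 -> R[i]) `^ 2)%E.
Proof.
move=> n0 fL2 a0 h0 c0 cf.
apply: le_trans
  (L2norm_chebyshev _ _ _ c fL2 (measurable_annulus n.+1 a h) c0 _).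
  rewrite EFinM; apply: lee_pmul => //; rewrite ?lee_fin ?sqr_ge0//.
    by rewrite mulr_ge0// exprn_ge0// divr_ge0.
  exact: annulus_measure_ge.
by move=> x; exact: cf.
Qed.

(** * Powers of a vanishing width *)

Lemma cvg0_powR {R : realType} (F : set_system R) (FF : Filter F)
    (L : R -> R) (p : R) :
  0 < p -> (\forall t \near F, 0 < L t) -> L t @[t --> F] --> (0 : R) ->
  L t `^ p @[t --> F] --> (0 : R).
Proof.
move=> p0 Lpos L0; apply: (cvg_comp _ _ _ (powR_cvg0 p0)) => S /= HS.
have := L0 _ HS; rewrite /= !near_simpl => /= H.
by apply: filterS2 Lpos H => t Lt; exact.
Qed.

(** For e < 0 the bound reads C <= M * L^(-e), whose right side tends to 0. *)
Lemma exponent_ge0 {R : realType} (F : set_system R) (FF : ProperFilter F)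
    (L : R -> R) (C M e : R) :
  0 < C -> (\forall t \near F, 0 < L t) -> L t @[t --> F] --> (0 : R) ->
  (\forall t \near F, C * L t `^ e <= M) -> 0 <= e.
Proof.
move=> C0 Lpos L0 bnd; rewrite leNgt; apply/negP => e0.
have ne0 : 0 < - e by rewrite oppr_gt0.
have cM : M * L t `^ (- e) @[t --> F] --> (M * 0 : R).
  by apply: cvgMl_tmp; exact: cvg0_powR.
have sm : \forall t \near F, M * L t `^ (- e) < C.
  by apply: (cvgr_lt _ cM); rewrite mulr0.
have [t [[Lt bt] st]] := filter_ex (filterI (filterI Lpos bnd) sm).
have : C * L t `^ e * L t `^ (- e) <= M * L t `^ (- e).
  by rewrite ler_wpM2r ?powR_ge0.
by rewrite powRN mulfK ?gt_eqF ?powR_gt0// -powRN leNgt st.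
Qed.

(** * The shrinking ring *)

Lemma ring_profile_peak_gt0 {R : realType} (Q : R -> R[i]) :
  ring_profile Q -> 0 < Normc.normc (Q 0).
Proof.
case=> _ _ [rho Qrho] Qmax; apply: lt_le_trans (Qmax rho).
by rewrite lt0r normc_ge0 andbT; apply: contra_neq Qrho; exact: Normc.eq0_normc.
Qed.

Lemma ring_profile_near_peak {R : realType} (Q : R -> R[i]) (rhoc : R) :
  ring_profile Q -> 0 < rhoc ->
  exists delta : R, [/\ 0 < delta, delta <= rhoc &
    forall rho, 0 <= rho <= delta ->
      Normc.normc (Q 0) / 2 < Normc.normc (Q rho)].
Proof.
move=> hQ rhoc0; have q0 := ring_profile_peak_gt0 Q hQ.
have [cRe cIm _ _] := hQ.
have q2 : Normc.normc (Q 0) / 2 < Normc.normc (Q 0) by lra.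
have : \forall rho \near (0 : R), Normc.normc (Q 0) / 2 < Normc.normc (Q rho).
  exact: (cvgr_gt _ (continuous_normc Q cRe cIm 0) _ q2).
move=> /nbhs_normP[e /= e0 He].
exists (Num.min (e / 2) rhoc); split.
- by rewrite lt_min rhoc0 andbT divr_gt0.
- by rewrite ge_min lexx orbT.
- move=> rho /andP[rho0]; rewrite le_min => /andP[rhoe _].
  by apply: He; rewrite /= sub0r normrN ger0_norm//; lra.
Qed.

Theorem lemma5 (R : realType) (d : nat) (sigma Tc r0 alpha : R)
    (psi0 : R -> R[i]) (psi : R -> R -> R[i])
    (rmax L : R -> R) (Q : R -> R[i])
    (hd : (2 <= d)%N) (hsigma : 4 / d%:R < sigma < 4) (hTc : 0 < Tc)
    (hsol : is_solution d sigma Tc psi0 psi)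
    (hsing : singular_at d Tc psi)
    (hrmax : is_ring_radius Tc psi rmax)
    (hring : ring_type Tc rmax)
    (hL : ring_width Tc L)
    (hQ : ring_profile Q)
    (hprofile : has_asymptotic_profile sigma Tc psi rmax L Q)
    (hr0 : 0 < r0) (halpha : alpha <= 1)
    (hrate : ring_radius_rate Tc r0 alpha rmax L) :
  [/\ alphaB d sigma <= alpha,
      0 < alphaB d sigma &
      rmax t @[t --> Tc^'-] --> (0 : R)].
Proof.
case: d hd hsigma hsol {hsing} => [//|n] n0 /andP[sigma_gt sigma_lt4].
rewrite ltnS in n0.
case=> [[psi0L2 _] [psiH2 _] _ power].
case: hL => Lpos L0.
case: hprofile => rhoc rhoc0 prof.
have n1 : 0 < n%:R :> R by rewrite ltr0n.
have s0 : 0 < sigma by apply: le_lt_trans sigma_gt; rewrite divr_ge0.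
have tI : \forall t \near Tc^'-, 0 <= t < Tc.
  near=> t; apply/andP; split; first by near: t; exact: nbhs_left_ge.
  by near: t; exact: nbhs_left_lt.
have LposF : \forall t \near Tc^'-, 0 < L t by apply: filterS tI.
have q0 := ring_profile_peak_gt0 Q hQ.
have [delta [delta0 delta_rhoc Qdelta]] :=
  ring_profile_near_peak Q rhoc hQ rhoc0.
set q := Normc.normc (Q 0) in q0 Qdelta.
have [K KE] : exists K : R, L2norm (radial psi0 : 'rV[R]_n.+1 -> R[i]) = K%:E.
  case: psi0L2 => _ _ fin.
  exists (fine (L2norm (radial psi0 : 'rV[R]_n.+1 -> R[i]))).
  by rewrite fineK// ge0_fin_numE// Lnorm_ge0.
have rlow : \forall t \near Tc^'-, r0 / 2 * L t `^ alpha <= rmax t.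
  have half1 : 2^-1 < 1 :> R by lra.
  have : \forall t \near Tc^'-, 2^-1 < rmax t / (r0 * L t `^ alpha).
    exact: (cvgr_gt _ hrate _ half1).
  apply: filterS2 LposF => t Lt.
  have la := powR_gt0 alpha Lt.
  by rewrite ltr_pdivlMr ?mulr_gt0// => /ltW; apply: le_trans; rewrite mulrA; lra.
have q4 : 0 < q / 4 by rewrite divr_gt0.
set C := (q / 4) ^+ 2 * (delta * (r0 / 2 / n%:R) ^+ n).
have C0 : 0 < C.
  by rewrite mulr_gt0 ?exprn_gt0// mulr_gt0// exprn_gt0// !divr_gt0.
(* Dropping constants, the power of the ring is at least the product of the
   squared amplitude L^(-4/sigma), the thickness L, and L^(alpha n), which is
   the order of rmax^n. *)
have e_ge0 : 0 <= 1 - 4 / sigma + alpha * n%:R.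
  apply: (exponent_ge0 (Tc^'-) (at_left_proper_filter Tc) L C (K `^ 2)
    (1 - 4 / sigma + alpha * n%:R) C0 LposF L0).
  have pq := prof _ q4.
  apply: filterS3 (filterI tI LposF) rlow pq => t [tin Lt] rt pt.
  have [H2 _] := psiH2 t tin.
  (* |Q| > q/2 on [0, delta], and the rescaled amplitude is within q/4 of |Q|. *)
  set c := q / 4 * L t `^ (- (2 / sigma)).
  have l2 := powR_gt0 (2 / sigma) Lt.
  have rm0 := hring t tin.
  have := L2norm_radial_ge n (psi t) c (rmax t) (delta * L t) n0 H2 (ltW rm0).
  rewrite (power t tin) KE poweR_EFin lee_fin.
  move=> /(_ (ltW (mulr_gt0 delta0 Lt)) (mulr_ge0 (ltW q4) (powR_ge0 _ _))) h.
  have {}h := h _; apply: le_trans (h _).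
    rewrite /C /c.
    have -> : L t `^ (1 - 4 / sigma + alpha * n%:R) =
        L t `^ (- (2 / sigma)) ^+ 2 * (L t * (L t `^ alpha) ^+ n).
      have Ln0 : L t != 0 by rewrite gt_eqF.
      have -> : 1 - 4 / sigma + alpha * n%:R =
          - (2 / sigma) * 2 + (1 + alpha * n%:R) by field; rewrite gt_eqF.
      rewrite !powRD ?Ln0 ?implybT// !powRrM !powR_mulrn ?powR_ge0//.
      by rewrite powRr1 ?ltW.
    rewrite mulrACA -exprMn ler_wpM2l ?sqr_ge0//.
    rewrite mulrACA -exprMn ler_pM2l ?mulr_gt0//.
    rewrite lerXn2r ?nnegrE//.
    - by rewrite mulr_ge0 ?powR_ge0 ?divr_ge0 // ?ltW ?divr_gt0.
    - by rewrite divr_ge0 // ltW.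
    - by rewrite mulrAC ler_pM2r ?invr_gt0.
  move=> r /andP[ra rb].
  set rho := (r - rmax t) / L t.
  have rhoE : r = rmax t + rho * L t.
    rewrite /rho divfK; last by rewrite gt_eqF.
    by rewrite addrC subrK.
  have rho0 : 0 <= rho by rewrite /rho divr_ge0 ?subr_ge0 // ltW.
  have rhod : rho <= delta by rewrite /rho ler_pdivrMr// lerBlDl.
  have := pt rho; rewrite ger0_norm// -rhoE => /(_ (le_trans rhod delta_rhoc)).
  move=> /(_ (lt_le_trans rm0 ra)); rewrite ltr_norml => /andP[lo _].
  have := Qdelta rho; rewrite rho0 rhod => /(_ isT) Ql.
  rewrite /c powRN ler_pdivrMr//; lra.
have alphaBE : alphaB n.+1 sigma = (4 - sigma) / (sigma * n%:R).
  by rewrite /alphaB -[n.+1%:R]natr1 addrK.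
have aB : alphaB n.+1 sigma <= alpha.
  rewrite alphaBE ler_pdivrMr ?mulr_gt0//.
  have : 0 <= sigma * (1 - 4 / sigma + alpha * n%:R) by rewrite mulr_ge0 // ltW.
  rewrite (_ : sigma * _ = sigma - 4 + alpha * (sigma * n%:R)); first lra.
  by field; rewrite gt_eqF.
have aB0 : 0 < alphaB n.+1 sigma.
  by rewrite alphaBE divr_gt0 ?mulr_gt0// subr_gt0.
split => //.
have La : L t `^ alpha @[t --> Tc^'-] --> (0 : R).
  by apply: cvg0_powR => //; exact: lt_le_trans aB.
have lim0 : rmax t / (r0 * L t `^ alpha) * (r0 * L t `^ alpha)
    @[t --> Tc^'-] --> (0 : R).
  rewrite -[0 : R](mulr0 1); apply: cvgM; first exact: hrate.
  by rewrite -[0 : R](mulr0 r0); exact: cvgMl_tmp.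
apply: cvg_trans lim0; apply: near_eq_cvg; near=> t.
rewrite divfK// gt_eqF// mulr_gt0// powR_gt0//.
by near: t; exact: LposF.
Unshelve. all: by end_near.
Qed.
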